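(* For real $\alpha<0$ and real $t>1$, \[ \mathbb E\bigl(|\mathcal T|-1+t\bigr)^{\alpha}=(t-1)^{\alpha}\int_0^1\Bigl[1-\frac{c(\eta;-\alpha,t)}{\Gamma(-\alpha)}\Bigr]\,d\eta, \qquad c(\eta;-\alpha,t):=\int_{(t-1)\log R(\eta)}^{\infty}v^{-\alpha-1}e^{-v}\,dv . \]
   Context: Let $\xi$ be a random variable with values in $\{0,1,2,\dots\}$ with $\mathbb E\xi=1$ and $0<\operatorname{Var}\xi<\infty$, with probability generating function $\Phi(t)=\mathbb E t^\xi$, and let $\mathcal T$ be a Galton–Watson tree with offspring distribution $\xi$, $|\mathcal T|$ its number of vertices. For $\eta\in(0,1]$, $R(\eta):=\Phi(\eta)/\eta\in[1,\infty)$. *)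

(* Defs.v *)
From HB Require Import structures.
From mathcomp Require Import all_boot all_order all_algebra.
From mathcomp Require Import all_classical all_reals all_analysis.
Set Implicit Arguments. Unset Strict Implicit. Unset Printing Implicit Defensive.
Import Order.TTheory GRing.Theory Num.Theory.
Import numFieldNormedType.Exports.
Local Open Scope classical_set_scope.
Local Open Scope ring_scope.

Section GW.
Variable R : realType.

Definition offspring_dist (p : nat -> R) : Prop :=
  [/\ (forall k, 0 <= p k),
      series p @ \oo --> (1 : R),
      series (fun k => k%:R * p k) @ \oo --> (1 : R),
      cvg (series (fun k => (k%:R) ^+ 2 * p k) @ \oo) &
      0 < limn (series (fun k => (k%:R - 1) ^+ 2 * p k))].

Definition pgf (p : nat -> R) (eta : R) : R :=
  limn (series (fun k => p k * eta ^+ k)).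

Definition Rratio (p : nat -> R) (eta : R) : R := pgf p eta / eta.

(* Lukasiewicz (depth-first) encoding of a plane tree with n vertices:
   k i = number of children of the i-th vertex in depth-first order;
   the sequence encodes a tree iff the partial sums satisfy
   sum_{i<j} k_i >= j for 1 <= j < n and sum_{i<n} k_i = n - 1. *)
Definition lukasiewicz (n : nat) (k : {ffun 'I_n -> 'I_n}) : bool :=
  [forall j : 'I_n, (0 < j)%N ==> (j <= \sum_(i < n | (i < j)%N) k i)%N]
  && (\sum_(i < n) (k i : nat) == n.-1)%N.

(* P(|T| = n) for the Galton-Watson tree T with offspring pmf p:
   sum over plane trees with n vertices of prod_v p(children of v). *)
Definition gw_size_prob (p : nat -> R) (n : nat) : R :=
  \sum_(k : {ffun 'I_n -> 'I_n} | lukasiewicz k) \prod_(i < n) p (k i).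

Definition Gammaf (s : R) : R :=
  fine (\int[lebesgue_measure]_(v in `]0%R, +oo[) ((v `^ (s - 1)) * expR (- v))%R%:E)%E.

Definition cfun (p : nat -> R) (eta s t : R) : R :=
  fine (\int[lebesgue_measure]_(v in `[((t - 1) * ln (Rratio p eta))%R, +oo[)
          ((v `^ (s - 1)) * expR (- v))%R%:E)%E.

End GW.

(* Main.v *)
Require Import Defs.
From HB Require Import structures.
From mathcomp Require Import all_boot all_order all_algebra.
From mathcomp Require Import all_classical all_reals all_analysis.
From mathcomp Require Import measurable_realfun ring lra.
Import Order.TTheory GRing.Theory Num.Theory.
Import numFieldNormedType.Exports.
Local Open Scope classical_set_scope.
Local Open Scope ring_scope.

(** A Galton-Watson tree is read off its Lukasiewicz path, a first passage of a
    left-continuous walk.  Writing [q n m] for the probability that the walk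
    started at [m] first hits 0 at time [n], the sums [sum_n q n m z^n] and the
    powers [eta^m] of a solution of [eta = z Phi(eta)] satisfy the same
    recursion, whose solution operator contracts by [z < 1] on bounded
    sequences.  Hence the generating function [G] of the size satisfies
    [G(1 / R(eta)) = eta], and by strict monotonicity of [G],
    [eta <= G(exp(-v))] iff [v <= log R(eta)].  Inserting
    [(n - 1 + t)^(-s) = Gamma(s)^-1 int_0^oo v^(s-1) exp(-v (n - 1 + t)) dv]
    into the moment gives the integral of [v^(s-1) exp(-v (t-1)) G(exp(-v))];
    [G(exp(-v))] is the length of [{eta | v <= log R(eta)}], so Tonelli's theorem
    and the substitution [w = (t - 1) v] yield the formula.  No regularity or
    monotonicity of [R] is needed. *)

(** * Lukasiewicz paths and first passages *)

(* Probability that the walk with steps [k - 1], [k] of law [p], started at [m]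
   first hits 0 at time [n]; truncating the sum is harmless since [n' < m]
   leaves too little time to descend to 0 (see [fpassS]). *)
Fixpoint fpass (R : pzRingType) (p : nat -> R) (n m : nat) : R :=
  match n, m with
  | 0%N, _ => (m == 0%N)%:R
  | n'.+1, 0%N => 0
  | n'.+1, m'.+1 => \sum_(k < n) p k * fpass R p n' (m' + k)
  end.
Arguments fpass {R}.

(** The walk with steps [k i - 1] is at [m + sum_(i < j) k i - j] at time [j]; moving [j] across
    avoids truncated subtraction. The alphabet size [B] is separate from [n], since removing a step
    shortens the word but keeps its letters. *)
Definition excursion (m n B : nat) (k : {ffun 'I_n -> 'I_B}) : bool :=
  [forall j : 'I_n, (j < m + \sum_(i < n | (i < j)%N) k i)%N]
  && (m + \sum_(i < n) k i == n)%N.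
Arguments excursion : clear implicits.

Definition ffun_cons (n : nat) (T : Type) (x : T) (f : {ffun 'I_n -> T}) :
    {ffun 'I_n.+1 -> T} :=
  [ffun i => oapp f x (unlift ord0 i)].
Arguments ffun_cons {n T}.

Lemma ffun_cons0 n T x f : @ffun_cons n T x f ord0 = x.
Proof. by rewrite ffunE unlift_none. Qed.

Lemma ffun_consS n T x f i : @ffun_cons n T x f (lift ord0 i) = f i.
Proof. by rewrite ffunE liftK. Qed.

Lemma ffun_cons_bij n (T : Type) :
  bijective (fun xf : T * {ffun 'I_n -> T} => ffun_cons xf.1 xf.2).
Proof.
exists (fun g : {ffun 'I_n.+1 -> T} => (g ord0, [ffun i => g (lift ord0 i)])).
  move=> [x f] /=; rewrite ffun_cons0; congr pair.
  by apply/ffunP => i; rewrite !ffunE liftK.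
move=> g /=; apply/ffunP => i; rewrite ffunE.
by case: unliftP => [j ->|->] //=; rewrite ffunE.
Qed.

(** After the first step the walk restarts from [m.-1 + x]; the condition at time 0 is what becomes
    [0 < m]. *)
Lemma excursion_cons m n B (x : 'I_B) (f : {ffun 'I_n -> 'I_B}) :
  excursion m n.+1 B (ffun_cons x f) = (0 < m)%N && excursion (m.-1 + x) n B f.
Proof.
have sumS (j : nat) : (\sum_(i < n.+1 | (i < j.+1)%N) ffun_cons x f i =
    x + \sum_(i < n | (i < j)%N) f i)%N.
  rewrite big_mkcond big_ord_recl /= ffun_cons0; congr addn.
  rewrite [RHS]big_mkcond; apply: eq_bigr => i _.
  by rewrite (ffun_consS n _ x f i).
rewrite /excursion; case: m => [|m] /=.
  by apply/negbTE/negP => /andP[/forallP/(_ ord0)]; rewrite /= big_pred0.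
congr andb.
  apply/forallP/forallP => [H i|H i].
    by have := H (lift ord0 i); rewrite sumS addSn ltnS addnA.
  case: (unliftP ord0 i) => [j ->|->] //.
  by rewrite sumS addSn ltnS addnA; exact: H.
rewrite big_ord_recl ffun_cons0 addSn eqSS addnA.
by congr (_ + _ == _)%N; apply: eq_bigr => i _; rewrite (ffun_consS n _ x f).
Qed.

Section first_passage.
Variables (R : pzRingType) (p : nat -> R).

(** A step lowers the walk by at most one. *)
Lemma fpass_gt n m : (n < m)%N -> fpass p n m = 0.
Proof.
elim: n m => [|n IH] [|m] //= nm.
by rewrite big1 // => k _; rewrite IH ?mulr0 //; exact: leq_trans nm (leq_addr _ _).
Qed.

(** The added terms start above the remaining time, so they vanish; one range [B] can then serve all
    times at once. *)
Lemma fpassS n m B : (n < B)%N ->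
  fpass p n.+1 m.+1 = \sum_(k < B) p k * fpass p n (m + k).
Proof.
move=> nB /=.
rewrite -(big_mkord xpredT (fun k => p k * fpass p n (m + k))).
rewrite -(big_mkord xpredT (fun k => p k * fpass p n (m + k))).
rewrite (big_cat_nat (leq0n _) nB) /= [X in _ = _ + X]big_nat_cond.
rewrite [X in _ = _ + X]big1 ?addr0 // => k /andP[/andP[nk _] _].
by rewrite fpass_gt ?mulr0 // (leq_trans nk) ?leq_addl.
Qed.

(** Induction on the length, splitting off the first step. For [n = 0] there is one empty word, an
    excursion exactly when [m = 0]. *)
Lemma sum_excursion (n m B : nat) : (n <= B)%N ->
  \sum_(k : {ffun 'I_n -> 'I_B} | excursion m n B k) \prod_(i < n) p (k i) =
  fpass p n m.
Proof.
elim: n m => [|n IH] m nB.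
  under eq_bigr do rewrite big_ord0.
  rewrite sumr_const.
  have -> : #|[pred k | excursion m 0 B k]| = (m == 0%N).
    case: eqP => [->|m0] /=.
      rewrite (@eq_card _ _ xpredT); first by rewrite card_ffun !card_ord expn0.
      move=> k; rewrite !inE /excursion big_ord0 addn0 eqxx andbT.
      by apply/forallP => -[].
    apply: eq_card0 => k; rewrite !inE /excursion big_ord0 addn0.
    by apply/negbTE; rewrite negb_and; apply/orP; right; apply/eqP.
  by [].
rewrite (reindex (fun xf : 'I_B * {ffun 'I_n -> 'I_B} => ffun_cons xf.1 xf.2)) /=;
  last exact: onW_bij (ffun_cons_bij _ _).
under eq_bigl do rewrite excursion_cons.
case: m => [|m] /=; first by rewrite big_pred0.
rewrite -[RHS]/(fpass p n.+1 m.+1) (fpassS _ _ B nB).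
rewrite -(pair_big_dep xpredT
   (fun (x : 'I_B) (f : {ffun 'I_n -> 'I_B}) => excursion (m + x) n B f)
   (fun x f => \prod_(i < n.+1) p (ffun_cons x f i))) /=.
apply: eq_bigr => x _; rewrite -IH ?(ltnW nB) // big_distrr /=.
apply: eq_bigr => f _; rewrite big_ord_recl ffun_cons0; congr (_ * _).
by apply: eq_bigr => i _; rewrite (ffun_consS n _ x f).
Qed.

End first_passage.

(** A Lukasiewicz word is an excursion from 1: at [j = 0] positivity is automatic, and total [n - 1]
    means ending at 0. At [n = 0] this breaks, since [0.-1 = 0] makes the empty word count as a
    tree. *)
Lemma gw_size_prob_fpass (R : realType) (p : nat -> R) n : (0 < n)%N ->
  gw_size_prob p n = fpass p n 1.
Proof.
move=> n0; rewrite -(sum_excursion _ p n 1 n (leqnn n)).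
apply: eq_bigl => k; rewrite /lukasiewicz /excursion; congr andb.
  apply/forallP/forallP => H j; last first.
    by apply/implyP => _; have := H j; rewrite add1n ltnS.
  case: (posnP j) => [->|j0]; first by rewrite add1n.
  by have /implyP/(_ j0) := H j; rewrite add1n ltnS.
have sumE S : (S == n.-1)%N = (1 + S == n)%N.
  by rewrite -[in RHS](prednK n0) add1n eqSS.
exact: sumE.
Qed.

(** * Generating function of the size *)

Section generating_function.
Variables (R : realType) (p : nat -> R).
Hypothesis p0 : forall k, 0 <= p k.
Hypothesis p1 : series p @ \oo --> (1 : R).

Lemma sum_pmf_le1 K : \sum_(k < K) p k <= 1.
Proof.
rewrite -(cvg_lim _ p1) // -(big_mkord xpredT p).
apply: (nondecreasing_cvgn_le (u_ := series p)); last by apply/cvg_ex; exists 1.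
exact: nondecreasing_series.
Qed.

Lemma fpass_ge0 n m : 0 <= fpass p n m.
Proof.
elim: n m => [|n IH] [|m] //=.
by apply: sumr_ge0 => k _; rewrite mulr_ge0.
Qed.

Definition fpass_psum (z : R) N m := \sum_(n < N.+1) fpass p n m * z ^+ n.

Lemma fpass_psum0 z N : fpass_psum z N 0 = 1.
Proof.
rewrite /fpass_psum big_ord_recl /= mulr1 big1 ?addr0 // => i _.
by rewrite mul0r.
Qed.

(** The time-0 term vanishes from a positive level, and [N < K] makes [fpassS] apply with the same
    [K] at every time up to [N], so the sums can be exchanged. *)
Lemma fpass_psumS z N m K : (N < K)%N ->
  fpass_psum z N.+1 m.+1 = z * \sum_(k < K) p k * fpass_psum z N (m + k).
Proof.
move=> NK; rewrite /fpass_psum big_ord_recl mul0r add0r.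
under [in RHS]eq_bigr do rewrite mulr_sumr.
rewrite exchange_big mulr_sumr; apply: eq_bigr => n _.
rewrite lift0 (fpassS _ _ _ _ K) ?(leq_ltn_trans _ NK) -1?ltnS //.
rewrite mulr_suml mulr_sumr; apply: eq_bigr => k _.
by rewrite exprS; ring.
Qed.

Lemma fpass_psum_ge0 z N m : 0 <= z -> 0 <= fpass_psum z N m.
Proof.
by move=> z0; apply: sumr_ge0 => n _; rewrite mulr_ge0 ?fpass_ge0 ?exprn_ge0.
Qed.

Lemma fpass_psum_le1 z N m : 0 <= z <= 1 -> fpass_psum z N m <= 1.
Proof.
move=> /andP[z0 z1]; elim: N m => [|N IH] [|m]; rewrite ?fpass_psum0 //.
  by rewrite /fpass_psum big_ord1 mul0r.
rewrite (fpass_psumS _ _ _ _ (ltnSn N)) mulr_ile1 ?sumr_ge0 // => [k _|].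
- by rewrite mulr_ge0 ?fpass_psum_ge0.
- apply: le_trans (sum_pmf_le1 N.+1); apply: ler_sum => k _.
  by rewrite ler_piMr.
Qed.

(* Both sides solve the first-passage recursion, which contracts by [z]. *)
Lemma fpass_psum_approx z eta N m : 0 <= z -> 0 <= eta <= 1 ->
  (fun K => z * series (fun k => p k * eta ^+ k) K) @ \oo --> eta ->
  `|fpass_psum z N m - eta ^+ m| <= z ^+ N.
Proof.
move=> z0 /andP[eta0 eta1] fix_eta.
elim: N m => [|N IH] [|m]; rewrite ?fpass_psum0 ?subrr ?normr0 ?exprn_ge0 //.
  rewrite /fpass_psum big_ord1 mul0r sub0r normrN ger0_norm ?exprn_ge0 //.
  by rewrite exprn_ile1.
(* The factor [eta] in [eta ^+ m.+1] is replaced by its approximants [z * series _ K], so that both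
   terms become averages over the same [k < K]. *)
have cvgm : (fun K => `|fpass_psum z N.+1 m.+1 -
    eta ^+ m * (z * series (fun k => p k * eta ^+ k) K)|) @ \oo -->
    `|fpass_psum z N.+1 m.+1 - eta ^+ m.+1|.
  by apply: cvg_norm; apply: cvgB; [exact: cvg_cst|rewrite exprSr; exact: cvgMr].
apply: (cvgr_to_le cvgm); near=> K.
have NK : (N < K)%N by near: K; exact: nbhs_infty_gt.
rewrite (fpass_psumS _ _ _ _ NK) mulrCA -mulrBr normrM ger0_norm // exprS.
rewrite ler_wpM2l // /series /= big_mkord mulr_sumr -sumrB.
apply: le_trans (ler_norm_sum _ _ _) _.
apply: (@le_trans _ _ (\sum_(k < K) p k * z ^+ N)).
  apply: ler_sum => k _.
  rewrite (_ : _ - _ = p k * (fpass_psum z N (m + k) - eta ^+ (m + k))).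
    by rewrite normrM ger0_norm // ler_wpM2l.
  by rewrite exprD; ring.
by rewrite -mulr_suml ler_piMl ?exprn_ge0 ?sum_pmf_le1.
Unshelve. all: by end_near. Qed.

Definition size_gf (z : R) := limn (series (fun n => fpass p n 1 * z ^+ n)).

Lemma series_fpass_psum z N m :
  series (fun n => fpass p n m * z ^+ n) N.+1 = fpass_psum z N m.
Proof. by rewrite /series /= big_mkord. Qed.

Lemma is_cvg_size_gf z : 0 <= z <= 1 ->
  cvgn (series (fun n => fpass p n 1 * z ^+ n)).
Proof.
move=> z01; have /andP[z0 _] := z01.
apply: nondecreasing_is_cvgn.
  by apply: nondecreasing_series => n _ _; rewrite mulr_ge0 ?fpass_ge0 ?exprn_ge0.
exists 1 => _ [[|N] _ <-]; first by rewrite /series /= big_geq.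
by rewrite series_fpass_psum fpass_psum_le1.
Qed.

Lemma size_gf_ge0 z : 0 <= z <= 1 -> 0 <= size_gf z.
Proof.
move=> z01; apply: limr_ge; first exact: is_cvg_size_gf.
have /andP[z0 _] := z01.
by near=> N; apply: sumr_ge0 => n _; rewrite mulr_ge0 ?fpass_ge0 ?exprn_ge0.
Unshelve. all: by end_near. Qed.

Lemma size_gf_le1 z : 0 <= z <= 1 -> size_gf z <= 1.
Proof.
move=> z01; apply: limr_le; first exact: is_cvg_size_gf.
apply: near_inftyS; apply: nearW => N.
by rewrite series_fpass_psum fpass_psum_le1.
Qed.

(** Let [N] grow in [fpass_psum_approx] at [m = 1]; the error [z ^+ N] vanishes because [z < 1]. *)
Lemma size_gf_fixpoint z eta : 0 <= z < 1 -> 0 <= eta <= 1 ->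
  (fun K => z * series (fun k => p k * eta ^+ k) K) @ \oo --> eta ->
  size_gf z = eta.
Proof.
move=> /andP[z0 z1] eta01 fix_eta; apply: cvg_lim => //.
rewrite -cvg_shiftS /=.
under eq_fun do rewrite series_fpass_psum.
apply: (cvg_sub0 _ (cvg_cst eta)).
apply/cvgr0Pnorm_le => e e0; near=> N.
have /le_trans := fpass_psum_approx z eta N 1 z0 eta01 fix_eta.
rewrite expr1; apply.
near: N.
have : (fun n => z ^+ n) @ \oo --> (0 : R) by apply: cvg_expr; rewrite ger0_norm.
by move=> /cvgr_le; apply.
Unshelve. all: by end_near. Qed.

(** The constant coefficient [fpass p 0 1] is 0, so [size_gf z / z] is again a power series with
    nonnegative coefficients, hence nondecreasing. This later supplies strict monotonicity. *)
Lemma size_gf_le (z1 z2 : R) : 0 <= z1 <= z2 -> z2 <= 1 ->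
  z2 * size_gf z1 <= z1 * size_gf z2.
Proof.
move=> /andP[z10 z12] z21.
have z20 : 0 <= z2 := le_trans z10 z12.
have c1 : (fun N => z2 * series (fun n => fpass p n 1 * z1 ^+ n) N) @ \oo
    --> z2 * size_gf z1.
  by apply: cvgMr; apply: is_cvg_size_gf; rewrite z10 (le_trans z12).
have c2 : (fun N => z1 * series (fun n => fpass p n 1 * z2 ^+ n) N) @ \oo
    --> z1 * size_gf z2.
  by apply: cvgMr; apply: is_cvg_size_gf; rewrite z20.
apply: (ler_cvg_to c1 c2); near=> N.
rewrite /series /= !mulr_sumr; apply: ler_sum => -[|n] _; first by rewrite !mul0r !mulr0.
rewrite mulrCA [leRHS]mulrCA ler_wpM2l ?fpass_ge0 // !exprS mulrCA.
by rewrite !ler_wpM2l // lerXn2r ?nnegrE.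
Unshelve. all: by end_near. Qed.

Lemma size_gf_nd (z1 z2 : R) : 0 <= z1 <= z2 -> z2 <= 1 -> size_gf z1 <= size_gf z2.
Proof.
move=> /andP[z10 z12] z21.
apply: ler_lim; try apply: is_cvg_size_gf.
- by rewrite z10 (le_trans z12).
- by rewrite (le_trans z10 z12).
near=> N; apply: ler_sum => n _; rewrite ler_wpM2l ?fpass_ge0 //.
by rewrite lerXn2r ?nnegrE // (le_trans z10).
Unshelve. all: by end_near. Qed.

End generating_function.

Arguments size_gf {R}.

(** * The ratio [Phi(eta) / eta] *)

(** Passing from [k] to [k.+1] leaves the gap [k (x - 1)^2]. The bound is the tangent at 1; under a
    law of mass and mean one these tangents average to [x]. *)
Lemma bernoulli_expr (R : realDomainType) (x : R) k : 0 <= x ->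
  1 + k%:R * (x - 1) <= x ^+ k.
Proof.
move=> x0; elim: k => [|k IH]; first by rewrite mul0r addr0 expr0.
rewrite exprS; apply: le_trans (ler_wpM2l x0 IH).
rewrite -natr1 -subr_ge0.
rewrite (_ : _ - _ = k%:R * (x - 1) ^+ 2); last by ring.
by rewrite mulr_ge0 ?ler0n ?sqr_ge0.
Qed.

Lemma bernoulli_expr_lt (R : realDomainType) (x : R) k : 0 <= x -> x != 1 ->
  (1 < k)%N -> 1 + k%:R * (x - 1) < x ^+ k.
Proof.
case: k => [|[|k]] // x0 x1 _.
rewrite exprS; apply: lt_le_trans (ler_wpM2l x0 (bernoulli_expr _ x k.+1 x0)).
rewrite -(natr1 k.+1) -subr_gt0.
rewrite (_ : _ - _ = k.+1%:R * (x - 1) ^+ 2); last by ring.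
by rewrite mulr_gt0 ?ltr0n // exprn_even_gt0 // subr_eq0 x1 orbT.
Qed.

Section offspring.
Variables (R : realType) (p : nat -> R).
Hypothesis op : offspring_dist p.

(** Otherwise [p] lives on 0 and 1, mean one forces [p 1 = 1], and the variance is 0. *)
Lemma offspring_branching : exists2 k, (1 < k)%N & 0 < p k.
Proof.
case: op => p0 p1 mean1 _ var_gt0; apply: contrapT => nobranch.
have pge2 k : (1 < k)%N -> p k = 0.
  move=> k1; apply/eqP; rewrite eq_le p0 andbT leNgt; apply/negP => pk.
  by apply: nobranch; exists k.
have tail (f : nat -> R) : (forall k, (1 < k)%N -> f k = 0) ->
    series f @ \oo --> f 0%N + f 1%N.
  move=> f0; apply: cvg_near_cst; near=> N.
  have N1 : (1 < N)%N by near: N; exact: nbhs_infty_gt.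
  rewrite /series /= (big_cat_nat (leq0n 2) N1) /= 2?big_nat_recr //= big_geq // add0r.
  rewrite big_nat_cond big1 ?addr0 // => k /andP[/andP[k1 _] _].
  exact: f0.
have s1 : p 0%N + p 1%N = 1.
  by rewrite -(cvg_lim _ (tail p pge2)) //; exact: cvg_lim.
have s2 : 0%:R * p 0%N + 1%:R * p 1%N = 1.
  rewrite -(cvg_lim _ (tail (fun k => k%:R * p k) _)) //; first exact: cvg_lim.
  by move=> k k1; rewrite pge2 ?mulr0.
move: var_gt0; rewrite (cvg_lim _ (tail (fun k => (k%:R - 1) ^+ 2 * p k) _)) //.
- have -> : p 0%N = 0 by lra.
  by rewrite subrr expr0n /= !(mul0r, mulr0, addr0) ltxx.
- by move=> k k1; rewrite /= pge2 ?mulr0.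
Unshelve. all: by end_near. Qed.

Lemma cvg_pgf (eta : R) : 0 <= eta <= 1 ->
  series (fun k => p k * eta ^+ k) @ \oo --> pgf p eta.
Proof.
case: op => p0 p1 _ _ _ /andP[eta0 eta1].
apply: (@series_le_cvg _ _ p) => // [k|k|].
- by rewrite mulr_ge0 ?exprn_ge0.
- by rewrite ler_piMr // exprn_ile1.
- by apply/cvg_ex; exists 1.
Qed.

Lemma pgf1 : pgf p 1 = 1.
Proof.
case: op => p0 p1 _ _ _; apply: cvg_lim => //.
by under eq_fun do rewrite expr1n mulr1.
Qed.

(** [pgf p eta - eta] is the sum of the gaps [g k] between [eta ^+ k] and its tangent at 1; all are
    nonnegative, and the one at a branching index [k0] is positive. *)
Lemma pgf_gt (eta : R) : 0 <= eta < 1 -> eta < pgf p eta.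
Proof.
move=> /andP[eta0 eta1]; case: (op) => p0 p1 mean1 _ _.
have [k0 k01 pk0] := offspring_branching.
pose g k := p k * (eta ^+ k - (1 + k%:R * (eta - 1))).
have g0 k : 0 <= g k by rewrite mulr_ge0 // subr_ge0 bernoulli_expr.
have gk0 : 0 < g k0 by rewrite mulr_gt0 // subr_gt0 bernoulli_expr_lt ?lt_eqF.
have cvg_g : series g @ \oo --> pgf p eta - (1 + (eta - 1) * 1).
  rewrite (_ : series g = fun N => series (fun k => p k * eta ^+ k) N -
      (series p N + (eta - 1) * series (fun k => k%:R * p k) N)).
    apply: cvgB; first by apply: cvg_pgf; rewrite eta0 ltW.
    by apply: cvgD => //; exact: cvgMr.
  apply/funext => N; rewrite /series /= mulr_sumr -big_split -sumrB /=.
  by apply: eq_bigr => k _; rewrite /g; ring.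
rewrite -subr_gt0; apply: (lt_le_trans gk0).
rewrite (_ : pgf p eta - eta = pgf p eta - (1 + (eta - 1) * 1)); last by ring.
apply: (cvgr_to_ge cvg_g); near=> N.
have kN : (k0 < N)%N by near: N; exact: nbhs_infty_gt.
rewrite /series /= big_mkord (bigD1 (Ordinal kN)) //= lerDl.
by apply: sumr_ge0.
Unshelve. all: by end_near. Qed.

Lemma pgf_ge (eta : R) : 0 <= eta <= 1 -> eta <= pgf p eta.
Proof.
rewrite le_eqVlt => /andP[]; rewrite [in X in _ -> X -> _]le_eqVlt.
move=> eta0 /predU1P[->|eta1]; first by rewrite pgf1.
by rewrite ltW // pgf_gt // le_eqVlt eta0.
Qed.

Lemma Rratio_gt0 (eta : R) : 0 < eta <= 1 -> 0 < Rratio p eta.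
Proof.
move=> /andP[eta0 eta1]; rewrite divr_gt0 //.
by rewrite (lt_le_trans eta0) // pgf_ge // ltW.
Qed.

Lemma Rratio_ge1 (eta : R) : 0 < eta <= 1 -> 1 <= Rratio p eta.
Proof.
by move=> /andP[eta0 eta1]; rewrite ler_pdivlMr // mul1r pgf_ge // ltW.
Qed.

(** [z = 1 / R(eta)] is the value that makes [eta = z * pgf p eta]; [pgf_gt] gives [z < 1], which is
    why [eta = 1] is excluded. *)
Lemma size_gf_Rratio_inv (eta : R) : 0 < eta < 1 -> size_gf p (Rratio p eta)^-1 = eta.
Proof.
move=> /andP[eta0 eta1]; case: (op) => p0 p1 _ _ _.
have pgf0 : eta < pgf p eta by rewrite pgf_gt // ltW.
apply: (size_gf_fixpoint R p p0 p1) => //; rewrite ?(ltW eta0) ?(ltW eta1) //.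
  by rewrite invr_ge0 ltW ?Rratio_gt0 ?eta0 ?ltW //= invf_lt1 ?Rratio_gt0
    ?eta0 ?ltW // ltr_pdivlMr // mul1r.
rewrite -[X in _ --> X](_ : (Rratio p eta)^-1 * pgf p eta = eta); last first.
  by rewrite invf_div divfK // gt_eqF // (lt_trans eta0).
by apply: cvgMr; apply: cvg_pgf; rewrite !ltW.
Qed.

(** Compare [exp (- v)] with [1 / R(eta)], where [size_gf] equals [eta]: monotonicity gives one
    implication, strict monotonicity the other. *)
Lemma le_size_gf_expRN (eta v : R) : 0 < eta <= 1 -> 0 < v ->
  (eta <= size_gf p (expR (- v))) = (v <= ln (Rratio p eta)).
Proof.
case: (op) => p0 p1 _ _ _ /andP[eta0 eta1] v0.
have ev0 : 0 <= expR (- v) by exact: expR_ge0.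
have ev1 : expR (- v) < 1 by rewrite -expR0 ltr_expR oppr_lt0.
have R0 : 0 < Rratio p eta by rewrite Rratio_gt0 ?eta0.
have lnE : (v <= ln (Rratio p eta)) = ((Rratio p eta)^-1 <= expR (- v)).
  by rewrite expRN lef_pV2 ?posrE ?expR_gt0 // -[in RHS](lnK R0) ler_expR.
rewrite lnE {lnE}.
move: eta1; rewrite le_eqVlt => /predU1P[eta1|eta1].
  (* At [eta = 1] both sides fail: [ln R = 0 < v], and [size_gf z <= z * size_gf 1 <= z < 1] for
     [z = exp (- v)]. *)
  subst eta; rewrite /Rratio pgf1 divr1 invr1 [RHS]leNgt ev1.
  apply/negbTE; rewrite -ltNge.
  have := size_gf_le R p p0 p1 (expR (- v)) 1.
  rewrite ev0 ltW //= mul1r => /(_ isT (lexx _))/le_lt_trans; apply.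
  apply: le_lt_trans ev1; rewrite ler_piMr //.
  by rewrite (size_gf_le1 R p p0 p1) // ler01 lexx.
have G : size_gf p (Rratio p eta)^-1 = eta by rewrite size_gf_Rratio_inv ?eta0.
apply/idP/idP; last first.
  move=> H; rewrite -[leLHS]G; apply: (size_gf_nd R p p0 p1) => //; last exact: ltW.
  by rewrite H invr_ge0 ltW.
apply: contraTT; rewrite -!ltNge => H.
have Rinv1 : (Rratio p eta)^-1 <= 1.
  by rewrite invf_le1 // Rratio_ge1 // eta0 ltW.
(* For [z = exp (- v) < 1 / R] this gives [size_gf z / R <= z * eta < eta / R], strict since
   [eta > 0]. *)
have := size_gf_le R p p0 p1 (expR (- v)) (Rratio p eta)^-1.
rewrite ev0 ltW //= G => /(_ isT Rinv1) /le_lt_trans H2.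
have : (Rratio p eta)^-1 * size_gf p (expR (- v)) < (Rratio p eta)^-1 * eta.
  by apply: H2; rewrite ltr_pM2r.
by rewrite ltr_pM2l ?invr_gt0.
Qed.

End offspring.

(** * Gamma integrals *)

Section scaling.
Context {R : realType}.
Notation mu := (@lebesgue_measure R).

Let scale (c : R) (x : measurableTypeR R) : measurableTypeR R := c * x.

Let measurable_scale c : measurable_fun setT (scale c).
Proof. by apply: measurable_funM. Qed.

Let pushforward_scale (c : R) : {nu : {measure set (measurableTypeR R) -> \bar R} |
  nu = pushforward mu (scale c) :> (set _ -> _)}.
Proof.
unshelve eexists (pushforward mu (scale c) : {measure set _ -> \bar R}).
  exact: measurable_scale.
by [].
Qed.

(** Scaling pulls []a, b]] back to an interval of length [(b - a) / c]; agreement on such intervals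
    determines Lebesgue measure. *)
Let lebesgue_measureZ (c : {posnum R}) (A : set R) : measurable A ->
  mu A = mscale c%:num%:nng (sval (pushforward_scale c%:num)) A.
Proof.
move=> mA.
have := (@lebesgue_measure_unique R
    (mscale c%:num%:nng (sval (pushforward_scale c%:num)))).
move=> H; apply: H => //;
move=> _ [[a b]] _ <-.
rewrite /= /mscale; case: (pushforward_scale c%:num) => nu /= ->; rewrite /pushforward.
rewrite (_ : _ @^-1` _ = `](a / c%:num)%R, (b / c%:num)%R]%classic); last first.
  apply/seteqP; split => x /=; rewrite !in_itv /= ltr_pdivrMr // ler_pdivlMr //;
  by rewrite /scale mulrC.
rewrite !lebesgue_measure_itv /= !lte_fin ltr_pM2r ?invr_gt0 //.
case: ifPn => _; last by rewrite mule0.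
by rewrite -!EFinB -EFinM -mulrBl mulrC divfK.
Qed.

Lemma ge0_integral_scale (c : R) (D : set R) (f : R -> \bar R) :
  0 < c -> measurable D -> measurable_fun D f ->
  (forall x, D x -> 0 <= f x)%E ->
  (\int[mu]_(x in D) f x =
   c%:E * \int[mu]_(x in [set x | D (c * x)%R]) f (c * x)%R)%E.
Proof.
move=> c0 mD mf f0.
rewrite (eq_measure_integral
  (mscale (PosNum c0)%:num%:nng (sval (pushforward_scale c)))); last first.
  by move=> A mA _; exact: (lebesgue_measureZ (PosNum c0)).
rewrite ge0_integral_mscale //= (svalP (pushforward_scale _)).
rewrite ge0_integral_pushforward //.
by move=> y /[!inE]; exact: f0.
Qed.

End scaling.

Section gamma.
Context {R : realType}.
Notation mu := (@lebesgue_measure R).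

Definition gamma_density (s v : R) : R := v `^ (s - 1) * expR (- v).

Lemma measurable_gamma_density s D : measurable_fun D (gamma_density s).
Proof.
apply: measurable_funTS; apply: measurable_funM; first exact: measurable_powR.
by apply: measurableT_comp => //.
Qed.

Lemma gamma_density_ge0 s v : 0 <= gamma_density s v.
Proof. by rewrite mulr_ge0 ?powR_ge0 ?expR_ge0. Qed.

(** The left side peaks at [v = a]; apply [ln x <= x - 1] at [x = v / a]. *)
Lemma powR_expRN_le (a v : R) : 0 < a -> 0 < v ->
  v `^ a * expR (- v) <= expR (a * ln a - a).
Proof.
move=> a0 v0; rewrite /powR gt_eqF // -expRD ler_expR.
have : ln (v / a) <= v / a - 1.
  have := @le_ln1Dx R (v / a - 1); rewrite addrCA subrr addr0; apply.
  by rewrite ltrBrDl subrr divr_gt0.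
rewrite ln_div ?posrE // => /(ler_wpM2l (ltW a0)).
rewrite !mulrBr mulrCA divff ?gt_eqF // mulr1; lra.
Qed.

(* [v ^ s / (1 + v ^ s)] is a bounded function whose derivative dominates the
   gamma density; up to an additive constant it is [sigmoid_powR]. *)
Definition sigmoid_powR (s v : R) : R := - (1 + v `^ s)^-1.
Definition sigmoid_powR' (s v : R) : R := (1 + v `^ s) ^- 2 * (s * v `^ (s - 1)).

Lemma is_derive_sigmoid_powR (s v : R) : 0 < v ->
  is_derive v 1 (sigmoid_powR s) (sigmoid_powR' s v).
Proof.
move=> v0.
have h : 1 + v `^ s != 0 by rewrite gt_eqF // ltr_wpDr ?powR_ge0.
have d := is_derive1_powR s v0.
have d2 : is_derive v 1 (fun x => 1 + x `^ s) (s * v `^ (s - 1)).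
  have := is_deriveD (is_derive_cst (1 : R) v 1) d.
  by rewrite add0r; apply.
have d3 := @is_deriveV R (fun x => 1 + x `^ s) v _ 1 h d2.
have := @is_deriveN _ _ _ _ _ _ _ d3.
by rewrite scaleNr opprK.
Qed.

Lemma derivable_sigmoid_powR' (s v : R) : 0 < v -> derivable (sigmoid_powR' s) v 1.
Proof.
move=> v0.
have h : (1 + v `^ s) ^+ 2 != 0 by rewrite expf_neq0 // gt_eqF // ltr_wpDr ?powR_ge0.
have d a : derivable (fun x : R => x `^ a) v 1.
  by have [] := is_derive1_powR a v0.
have d1 : derivable (fun x : R => 1 + x `^ s) v 1.
  by have := derivableD (derivable_cst (1 : R) v 1) (d s).
have d2 : derivable (fun x : R => (1 + x `^ s) ^+ 2) v 1.
  by have := derivableX (n := 2) d1.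
have d3 : derivable (fun x : R => (1 + x `^ s) ^- 2) v 1.
  by have := @derivableV R R (fun x : R => (1 + x `^ s) ^+ 2) v 1 h d2.
have d4 : derivable (fun x : R => s * x `^ (s - 1)) v 1.
  by have := derivableM (derivable_cst s v 1) (d (s - 1)).
by have := derivableM d3 d4.
Qed.

(** With [x = v ^ s], [(1 + x)^2 <= 2 + 2 x^2], while [exp (- v) <= 1] and [x^2 exp (- v) <= K] by
    [powR_expRN_le] at [a = 2 s]. Dividing by [s] cancels the factor from the derivative. *)
Lemma gamma_density_le_sigmoid (s v : R) : 0 < s -> 0 < v ->
  gamma_density s v <=
  (2 + 2 * expR (2 * s * ln (2 * s) - 2 * s)) / s * sigmoid_powR' s v.
Proof.
move=> s0 v0; rewrite /gamma_density /sigmoid_powR'.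
set K := expR (2 * s * _ - _).
have x0 : 0 <= v `^ s by exact: powR_ge0.
rewrite [leRHS](_ : _ = v `^ (s - 1) * ((2 + 2 * K) * (1 + v `^ s) ^- 2)); last first.
  by field; rewrite gt_eqF ?ltr_wpDr //= gt_eqF.
rewrite ler_wpM2l ?powR_ge0 // ler_pdivlMr ?exprn_gt0 ?ltr_wpDr //.
have e1 : expR (- v) <= 1 by rewrite -expR0 ler_expR oppr_le0 ltW.
have e0 : 0 <= expR (- v) by exact: expR_ge0.
have : (v `^ s) ^+ 2 * expR (- v) <= K.
  rewrite -powR_mulrn // -powRrM mulrC [s * _]mulrC mulrC.
  by apply: powR_expRN_le; rewrite ?mulr_gt0.
have : 0 <= expR (- v) * (1 - v `^ s) ^+ 2 by rewrite mulr_ge0 ?sqr_ge0.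
move: e1; move: (v `^ s) (expR (- v)) K => x e K; nra.
Qed.


(** The bound is uniform in [a] and [b]: [sigmoid_powR] takes values in [[-1, 0]], so it increases
    by at most 1. *)
Lemma integral_gamma_density_itv_le (s a b : R) : 0 < s -> 0 < a -> a < b ->
  (\int[mu]_(v in `[a, b]) (gamma_density s v)%:E <=
   ((2 + 2 * expR (2 * s * ln (2 * s) - 2 * s)) / s)%:E)%E.
Proof.
move=> s0 a0 ab; set C := (X in (_ <= X%:E)%E).
have C0 : 0 <= C by rewrite divr_ge0 ?(ltW s0) // addr_ge0 // mulr_ge0 ?expR_ge0.
have pos v : v \in `[a, b] -> 0 < v.
  by rewrite in_itv /= => /andP[/(lt_le_trans a0)].
have cont : {within `[a, b], continuous (sigmoid_powR' s)}.
  apply: derivable_within_continuous => v /pos v0.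
  exact: derivable_sigmoid_powR'.
have contF v : 0 < v -> {for v, continuous (sigmoid_powR s)}.
  move=> v0; apply: differentiable_continuous; apply/derivable1_diffP.
  by have [] := is_derive_sigmoid_powR s v v0.
have FTC : (\int[mu]_(v in `[a, b]) (sigmoid_powR' s v)%:E =
    (sigmoid_powR s b)%:E - (sigmoid_powR s a)%:E)%E.
  apply: continuous_FTC2 => //.
    split.
    - move=> v; rewrite in_itv /= => /andP[av _].
      by have [] := is_derive_sigmoid_powR s v (lt_trans a0 av).
    - by apply: cvg_at_right_filter; apply: contF.
    - by apply: cvg_at_left_filter; apply: contF; exact: lt_trans ab.
  move=> v; rewrite in_itv /= => /andP[av _].
  rewrite derive1E.
  by have [_ ->] := is_derive_sigmoid_powR s v (lt_trans a0 av).
have m' : measurable_fun `[a, b] (sigmoid_powR' s).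
  by apply: subspace_continuous_measurable_fun => //; exact: measurable_itv.
have pos' v : 0 < v -> 0 <= sigmoid_powR' s v.
  move=> v0; rewrite mulr_ge0 ?invr_ge0 ?exprn_ge0 ?addr_ge0 ?powR_ge0 //.
  by rewrite mulr_ge0 ?powR_ge0 ?ltW.
apply: (@le_trans _ _ (\int[mu]_(v in `[a, b]) (C%:E * (sigmoid_powR' s v)%:E))%E).
  apply: ge0_le_integral => //.
  - by move=> v _; rewrite lee_fin gamma_density_ge0.
  - by apply/measurable_EFinP; exact: measurable_gamma_density.
  - by apply: measurable_funeM; exact/measurable_EFinP.
  - move=> v /pos v0; rewrite -EFinM lee_fin; exact: gamma_density_le_sigmoid.
rewrite ge0_integralZl_EFin //; last 2 first.
- by move=> v /pos v0; rewrite lee_fin pos'.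
- exact/measurable_EFinP.
rewrite FTC -EFinB -EFinM lee_fin ler_piMr // /sigmoid_powR opprK addrC.
have h1 (v : R) : 1 <= 1 + v `^ s by rewrite lerDl powR_ge0.
rewrite lerBlDr (@le_trans _ _ 1) ?invf_le1 ?(lt_le_trans _ (h1 a)) //.
by rewrite lerDl invr_ge0 (le_trans _ (h1 b)).
Qed.

Lemma integral_gamma_density_lty (s : R) : 0 < s ->
  (\int[mu]_(v in `]0%R, +oo[) (gamma_density s v)%:E < +oo)%E.
Proof.
move=> s0.
(* The shift by 2 gives strictly ordered endpoints already at [n = 0]. *)
pose F (n : nat) : set R := `[n.+2%:R^-1, n.+2%:R]%classic.
have -> : `]0%R, +oo[%classic = \bigcup_n F n.
  apply/seteqP; split => [v|v [n _]] /=; last first.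
    rewrite /F /= !in_itv /= andbT => /andP[/lt_le_trans + _]; apply.
    by rewrite invr_gt0.
  rewrite in_itv /= andbT => v0.
  pose n := maxn (Num.truncn v) (Num.truncn v^-1).
  have lt_n (x : R) : 0 <= x -> (Num.truncn x <= n)%N -> x <= n.+2%:R.
    move=> x0 xn; apply/ltW/(lt_le_trans (truncnS_gt x)).
    by rewrite ler_nat ltnS (leq_trans xn).
  exists n => //; rewrite /F /= in_itv /=; apply/andP; split.
    rewrite invf_ple ?posrE //; apply: lt_n; first by rewrite invr_ge0 ltW.
    exact: leq_maxr.
  by apply: lt_n; [exact: ltW|exact: leq_maxl].
have Fpos n v : F n v -> 0 < v.
  rewrite /F /= in_itv /= => /andP[/lt_le_trans + _]; apply.
  by rewrite invr_gt0.
have cvgF : (\int[mu]_(v in F n) (gamma_density s v)%:E @[n --> \oo] -->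
    \int[mu]_(v in \bigcup_n F n) (gamma_density s v)%:E)%E.
  apply: ge0_nondecreasing_set_cvg_integral => //.
  - apply/nondecreasing_seqP => n; rewrite subsetEset => v.
    rewrite /F /= !in_itv /= => /andP[h1 h2]; apply/andP; split.
      by apply: le_trans h1; rewrite lef_pV2 ?posrE // ler_nat.
    by apply: (le_trans h2); rewrite ler_nat.
  - by move=> n; exact: measurable_itv.
  - by move=> n; apply/measurable_EFinP; exact: measurable_gamma_density.
  - by move=> n v _; rewrite lee_fin gamma_density_ge0.
rewrite -(cvg_lim _ cvgF) //.
apply: (@le_lt_trans _ _ ((2 + 2 * expR (2 * s * ln (2 * s) - 2 * s)) / s)%:E);
  last exact: ltry.
apply: lime_le; first by apply/cvg_ex; eexists; exact: cvgF.
apply: nearW => n; apply: integral_gamma_density_itv_le => //.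
by apply: (@lt_trans _ _ 1); rewrite ?invf_lt1 ?ltr1n.
Qed.

(** On [[1, 2]], [v ^ (s - 1) >= 1 / v >= 1 / 2] and [exp (- v) >= exp (- 2)]. *)
Lemma integral_gamma_density_gt0 (s : R) : 0 < s ->
  (0 < \int[mu]_(v in `]0%R, +oo[) (gamma_density s v)%:E)%E.
Proof.
move=> s0.
apply: (@lt_le_trans _ _ (\int[mu]_(v in `[1%R, 2%R]) (cst (2^-1 * expR (- 2))%:E) v)%E).
  rewrite integral_cst //= lebesgue_measure_itv /= lte_fin ltr1n.
  rewrite -EFinB -EFinM lte_fin.
  by rewrite !mulr_gt0 ?expR_gt0 ?invr_gt0 // subr_gt0 ltr1n.
apply: (@le_trans _ _ (\int[mu]_(v in `[1%R, 2%R]) (gamma_density s v)%:E)%E).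
  apply: ge0_le_integral => //.
  - by move=> v _; rewrite lee_fin mulr_ge0 ?expR_ge0 ?invr_ge0.
  - by apply/measurable_EFinP; exact: measurable_gamma_density.
  move=> v /=; rewrite in_itv /= => /andP[v1 v2]; rewrite lee_fin.
  apply: ler_pM; rewrite ?expR_ge0 ?invr_ge0 //; last by rewrite ler_expR lerN2.
  apply: (@le_trans _ _ (v `^ (- 1))).
    by rewrite powR_inv1 ?lef_pV2 ?posrE ?(le_trans _ v1) // (lt_le_trans _ v1).
  by apply: ler_powR => //; rewrite lerDr ltW.
apply: ge0_subset_integral => //.
- by apply/measurable_EFinP; exact: measurable_gamma_density.
- by move=> v _; rewrite lee_fin gamma_density_ge0.
- move=> v /=; rewrite !in_itv /= andbT => /andP[v1 _]; exact: lt_le_trans v1.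
Qed.

End gamma.

Section gamma_integrals.
Context {R : realType}.
Notation mu := (@lebesgue_measure R).

Lemma Gammaf_gt0 (s : R) : 0 < s -> 0 < Gammaf s.
Proof.
move=> s0; apply: fine_gt0.
by rewrite integral_gamma_density_gt0 //= integral_gamma_density_lty.
Qed.

Lemma EFin_Gammaf (s : R) : 0 < s ->
  (\int[mu]_(v in `]0%R, +oo[) (gamma_density s v)%:E = (Gammaf s)%:E)%E.
Proof.
move=> s0; rewrite /Gammaf fineK // ge0_fin_numE.
  exact: integral_gamma_density_lty.
by apply: integral_ge0 => v _; rewrite lee_fin gamma_density_ge0.
Qed.

(** Substitution [w = c v]. A general [D] covers both the half-line and the interval cut off at
    [T * ln R]. *)
Lemma integral_gamma_density_scale (s c : R) (D : set R) : 0 < c ->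
  measurable D -> D `<=` `]0, +oo[ ->
  (\int[mu]_(v in [set v | D (c * v)%R]) (v `^ (s - 1) * expR (- (c * v)))%:E =
   (c `^ (- s))%:E * \int[mu]_(v in D) (gamma_density s v)%:E)%E.
Proof.
move=> c0 mD Dpos.
have mcD : measurable [set v | D (c * v)%R].
  have /(_ measurableT D mD) := @mulrl_measurable R setT c.
  by rewrite setTI.
rewrite (@ge0_integral_scale _ c D) //; last 2 first.
- by apply/measurable_EFinP; exact: measurable_gamma_density.
- by move=> v _; rewrite lee_fin gamma_density_ge0.
rewrite muleA -EFinM -ge0_integralZl_EFin //; last 3 first.
- by move=> v _; rewrite lee_fin gamma_density_ge0.
- apply/measurable_EFinP.
  apply: (@measurable_comp _ _ _ _ _ _ setT (gamma_density s) _ ( *%R c)) => //.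
    exact: measurable_gamma_density.
- by rewrite mulr_ge0 ?powR_ge0 ?ltW.
apply: eq_integral => v; rewrite inE /= => /Dpos.
rewrite /= in_itv /= andbT pmulr_rgt0 // => v0.
rewrite -EFinM; congr EFin; rewrite /gamma_density powRM ?ltW //.
have -> : c `^ (s - 1) = c `^ s / c.
  by rewrite powRD ?(gt_eqF c0) ?implybT // powR_inv1 ?ltW.
by rewrite powRN; field; rewrite !gt_eqF ?powR_gt0.
Qed.

Lemma integral_gamma_density_lower (s x : R) : 0 < s -> 0 <= x ->
  (\int[mu]_(v in `]0%R, x]) (gamma_density s v)%:E =
   (Gammaf s - fine (\int[mu]_(v in `[x, +oo[) (gamma_density s v)%:E))%:E)%E.
Proof.
move=> s0 x0.
have mg D : measurable_fun D (fun v => (gamma_density s v)%:E).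
  by apply/measurable_EFinP; exact: measurable_gamma_density.
have g0 v : (0 <= (gamma_density s v)%:E)%E.
  by rewrite lee_fin gamma_density_ge0.
(* Dropping the null endpoint [x] makes the two pieces of the half-line disjoint. *)
rewrite -integral_itv_obnd_cbnd //.
have fin : (\int[mu]_(v in `]x, +oo[) (gamma_density s v)%:E \is a fin_num)%E.
  rewrite ge0_fin_numE; last by apply: integral_ge0 => v _; exact: g0.
  apply: le_lt_trans (integral_gamma_density_lty s s0).
  apply: ge0_subset_integral => //; first exact: mg.
  by move=> v /=; rewrite !in_itv /= !andbT; exact: le_lt_trans.
rewrite EFinB -EFin_Gammaf // fineK //.
have -> : `]0, +oo[%classic = `]0, x] `|` `]x, +oo[ :> set R.
  apply/seteqP; split => [v|v [|]] /=; rewrite !in_itv /= ?andbT.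
  - by move=> v0; rewrite v0 /=; case: (leP v x) => _; [left|right].
  - by move=> /andP[].
  - exact: le_lt_trans.
rewrite ge0_integral_setU //.
- by rewrite addeK.
- exact: mg.
- apply/disj_setPS => v [] /=; rewrite !in_itv /= andbT => /andP[_ vx].
  by rewrite ltNge vx.
Qed.

End gamma_integrals.

(** * Exchanging the integrations over [eta] and [v] *)

Section tonelli.
Context {R : realType}.
Variables (p : nat -> R).
Hypothesis op : offspring_dist p.
Notation mu := (@lebesgue_measure R).

(** Clamping at 0 keeps the argument of [size_gf] in [[0, 1]], which makes the function monotone,
    hence measurable, on the whole line. *)
Let size_gfexp (v : R) := size_gf p (expR (- Num.max v 0)).

Let expRN_max_itv (v : R) : 0 <= expR (- Num.max v 0) <= 1.
Proof.
by rewrite expR_ge0 -expR0 ler_expR oppr_le0 le_max lexx orbT.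
Qed.

Let measurable_size_gfexp : measurable_fun setT size_gfexp.
Proof.
case: (op) => p0 p1 _ _ _.
apply: nonincreasing_measurable => // x y xy.
have /andP[y0 y1] := expRN_max_itv y; have /andP[x0 x1] := expRN_max_itv x.
apply: (size_gf_nd R p p0 p1) => //; rewrite expR_ge0 /= ler_expR lerN2.
by rewrite ge_max !le_max xy lexx /= orbT.
Qed.

(* [size_gf (exp (- v))] is the length of the set of [eta] in ]0, 1] with
   [v <= ln (Rratio p eta)]. *)
Lemma tonelli_size_gf (W : R -> R) : measurable_fun setT W -> (forall v, 0 <= W v) ->
  (\int[mu]_(v in `]0%R, +oo[) (W v * size_gf p (expR (- v)))%:E =
   \int[mu]_(eta in `]0%R, 1%R])
     \int[mu]_(v in `]0%R, ln (Rratio p eta)]) (W v)%:E)%E.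
Proof.
move=> mW W0; case: (op) => p0 p1 _ _ _.
pose D : set (R * R) := `]0, +oo[ `*` `]0, 1].
(* [W] is integrated over the region under the graph of [size_gfexp], first by sections in [eta],
   then by sections in [v]. *)
pose A := D `&` [set x | x.2 <= size_gfexp x.1].
have memA v eta : ((v, eta) \in A) =
    [&& 0 < v, 0 < eta <= 1 & eta <= size_gfexp v].
  rewrite /A /D; apply/idP/and3P => [|[v0 eta01 le_eta]].
    by rewrite inE => -[[]] /=; rewrite !in_itv /= andbT.
  by rewrite inE; do 2?split => //=; rewrite in_itv /= ?andbT.
have mA : measurable A.
  apply: measurable_fun_le; first by apply: measurableX; exact: measurable_itv.
    by apply: measurable_funTS; exact: measurable_snd.
  by apply: measurable_funTS; exact: (measurableT_comp measurable_size_gfexp).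
pose f (x : R * R) : \bar R := (W x.1 * \1_A x)%:E.
have mf : measurable_fun setT f.
  apply/measurable_EFinP; apply: measurable_funM.
    exact: (measurableT_comp mW).
  exact: measurable_indic.
have f0 x : (0 <= f x)%E by rewrite lee_fin mulr_ge0.
transitivity (\int[mu]_v \int[mu]_eta f (v, eta))%E.
  symmetry.
  rewrite [RHS]integral_mkcond; apply: eq_integral => v _.
  rewrite patchE mem_setE in_itv /= andbT; case: ifPn => v0; last first.
      by apply: integral0_eq => eta _; rewrite /f indicE memA (negbTE v0) mulr0.
  have size01 : 0 <= size_gf p (expR (- v)) <= 1.
    have := expRN_max_itv v; rewrite (max_l (ltW v0)) => ev.
    by rewrite (size_gf_ge0 R p p0 p1) ?(size_gf_le1 R p p0 p1).
  have /andP[s0 s1] := size01.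
  (* Since [size_gf] is at most 1, the constraint [eta <= 1] is absorbed by the graph. *)
  transitivity (\int[mu]_eta ((W v)%:E *
      (\1_(`]0%R, size_gf p (expR (- v))]%classic) eta)%:E))%E.
    apply: eq_integral => eta _; rewrite /f -EFinM; congr (_ * _)%:E.
    rewrite !indicE; congr (_%:R); congr nat_of_bool.
    rewrite memA mem_setE in_itv /= v0 /size_gfexp (max_l (ltW v0)) /=.
    apply/idP/idP => [/andP[/andP[-> _] ->] //|/andP[-> le_g]].
    by rewrite le_g (le_trans le_g s1).
  rewrite ge0_integralZl_EFin //; last first.
    by apply/measurable_EFinP; exact: measurable_indic.
  rewrite integral_indic //= setIT lebesgue_measure_itv /= lte_fin.
  rewrite EFinM; congr (_ * _)%E; case: ltP => [_|]; first by rewrite -EFinB subr0.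
  by move=> h; apply/eqP; rewrite eqe eq_le s0 h.
transitivity (\int[mu]_eta \int[mu]_v f (v, eta))%E.
  exact: (fubini_tonelli (m1 := mu) (m2 := mu) f mf f0).
rewrite [RHS]integral_mkcond; apply: eq_integral => eta _.
rewrite patchE mem_setE; case: ifPn => eta01; last first.
  apply: integral0_eq => v _; rewrite /f indicE memA.
  by move: eta01; rewrite in_itv /= => /negbTE ->; rewrite andbF mulr0.
rewrite [RHS]integral_mkcond; apply: eq_integral => v _.
move: eta01; rewrite in_itv /= => eta01.
rewrite patchE mem_setE in_itv /= /f indicE memA eta01 /=.
case: ltP => v0 /=; last by rewrite mulr0.
rewrite -(le_size_gf_expRN R p op) // /size_gfexp (max_l (ltW v0)).
by case: leP => _; rewrite ?mulr1 ?mulr0.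
Qed.

End tonelli.

(** * Moments of the size *)

Lemma eseries_EFin_lim (R : realType) (u : nat -> R) (l : R) :
  series u @ \oo --> l -> (\sum_(n <oo) (u n)%:E = l%:E)%E.
Proof.
move=> ul; apply: cvg_lim => //.
under eq_fun do rewrite sumEFin.
by apply: cvg_EFin; [exact: nearW|exact: ul].
Qed.

Section moment.
Context {R : realType}.
Variables (p : nat -> R) (s T : R).
Hypotheses (op : offspring_dist p) (s0 : 0 < s) (T0 : 0 < T).
Notation mu := (@lebesgue_measure R).

(** With [T = t - 1] and [s = - alpha], the term of the moment at size [n]; it is 0 at [n = 0]. *)
Let u n := fpass p n 1 * (T + n%:R) `^ (- s).

Let Tn_gt0 n : 0 < T + n%:R. Proof. by rewrite ltr_wpDr. Qed.

Let is_cvg_u : cvgn (series u).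
Proof.
case: (op) => p0 p1 _ _ _.
apply: (@series_le_cvg _ _ (fun n => T `^ (- s) * (fpass p n 1 * 1 ^+ n))).
- by move=> n; rewrite mulr_ge0 ?fpass_ge0 ?powR_ge0.
- by move=> n; rewrite !mulr_ge0 ?fpass_ge0 ?powR_ge0 ?expr1n.
- move=> n; rewrite expr1n mulr1 /u mulrC ler_wpM2r ?fpass_ge0 //.
  rewrite !powRN lef_pV2 ?posrE ?powR_gt0 // ge0_ler_powR // ?nnegrE
    ?(ltW s0) ?(ltW T0) ?(ltW (Tn_gt0 n)) //.
  by rewrite lerDl.
- by apply: is_cvg_seriesZ; apply: is_cvg_size_gf => //; rewrite ler01 lexx.
Qed.

Let K := T `^ s / Gammaf s.

Let K0 : 0 <= K.
Proof. by rewrite divr_ge0 ?powR_ge0 // ltW // Gammaf_gt0. Qed.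

(** On the positive axis, the density of the Gamma law of shape [s] and rate [T]. *)
Let W (v : R) := K * (v `^ (s - 1) * expR (- (T * v))).

Let measurable_kernel c : measurable_fun setT
  (fun v : R => v `^ (s - 1) * expR (- (c * v))).
Proof.
apply: measurable_funM; first exact: measurable_powR.
apply: measurableT_comp => //.
by apply: measurableT_comp => //; exact: mulrl_measurable.
Qed.

Let kernel_ge0 c (v : R) : 0 <= v `^ (s - 1) * expR (- (c * v)).
Proof. by rewrite mulr_ge0 ?powR_ge0 ?expR_ge0. Qed.

Let measurable_W : measurable_fun setT W.
Proof. by apply: measurable_funM => //; exact: measurable_kernel. Qed.

Let W0 v : 0 <= W v. Proof. by rewrite mulr_ge0. Qed.

Let integral_kernel c : 0 < c ->
  (\int[mu]_(v in `]0%R, +oo[) (v `^ (s - 1) * expR (- (c * v)))%:E =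
   (c `^ (- s) * Gammaf s)%:E)%E.
Proof.
move=> c0; rewrite EFinM -EFin_Gammaf //.
rewrite -integral_gamma_density_scale //; congr (integral _ _ _).
by apply/seteqP; split => v /=; rewrite !in_itv /= !andbT pmulr_rgt0.
Qed.

(** Integrate the nonnegative power series termwise: the factor [exp (- v) ^+ n] raises the rate to
    [T + n], and [Gammaf s] cancels. *)
Let integral_W_size_gf :
  (\int[mu]_(v in `]0%R, +oo[) (W v * size_gf p (expR (- v)))%:E =
   (T `^ s * limn (series u))%:E)%E.
Proof.
case: (op) => p0 p1 _ _ _.
have fp n := fpass_ge0 R p p0 n 1.
transitivity (\int[mu]_(v in `]0%R, +oo[)
    (\sum_(n <oo) (W v * (fpass p n 1 * expR (- v) ^+ n))%:E))%E.
  apply: eq_integral => v; rewrite inE /= in_itv /= andbT => v0.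
  apply/esym/eseries_EFin_lim.
  rewrite (_ : series _ =
    fun N => W v * series (fun n => fpass p n 1 * expR (- v) ^+ n) N).
    apply: cvgMr; apply: is_cvg_size_gf => //.
    by rewrite expR_ge0 -expR0 ler_expR oppr_le0 ltW.
  by apply/funext => N; rewrite /series /= mulr_sumr.
rewrite integral_nneseries //; last 2 first.
- move=> n; apply/measurable_EFinP/measurable_funTS.
  apply: measurable_funM; first exact: measurable_W.
  apply: measurable_funM => //; apply: measurable_funX.
  by apply: measurableT_comp => //.
- by move=> n v _; rewrite lee_fin mulr_ge0 ?W0 // mulr_ge0 ?fp ?exprn_ge0 ?expR_ge0.
transitivity (\sum_(n <oo) (T `^ s * u n)%:E)%E.
  apply: eq_eseriesr => n _.
  transitivity (\int[mu]_(v in `]0%R, +oo[) ((K * fpass p n 1)%:E *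
      (v `^ (s - 1) * expR (- ((T + n%:R) * v)))%:E))%E.
    apply: eq_integral => v _; rewrite -EFinM; congr EFin.
    rewrite /W mulrDl opprD expRD -expRM_natl mulrN; ring.
  rewrite ge0_integralZl_EFin //; last 3 first.
  - by move=> v _; rewrite lee_fin.
  - by apply/measurable_EFinP/measurable_funTS; exact: measurable_kernel.
  - by rewrite mulr_ge0.
  rewrite integral_kernel // -EFinM /u /K; congr EFin.
  by field; rewrite gt_eqF // Gammaf_gt0.
apply: eseries_EFin_lim.
rewrite (_ : series (fun n => T `^ s * u n) = fun N => T `^ s * series u N);
  first by apply: cvgMr; exact: is_cvg_u.
by apply/funext => N; rewrite /series /= mulr_sumr.
Qed.

(** Rescaling by [T] moves the cut-off to [T * ln R], the lower limit in [cfun] at [t = 1 + T]; the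
    lower part is the complement of that tail. *)
Let integral_W_lower eta : 0 < eta <= 1 ->
  (\int[mu]_(v in `]0%R, ln (Rratio p eta)]) (W v)%:E =
   (1 - cfun p eta s (1 + T) / Gammaf s)%:E)%E.
Proof.
move=> eta01; set L := ln (Rratio p eta).
have L0 : 0 <= L by rewrite ln_ge0 // Rratio_ge1.
transitivity (\int[mu]_(v in `]0%R, L]) (K%:E *
    (v `^ (s - 1) * expR (- (T * v)))%:E))%E.
  by apply: eq_integral => v _; rewrite -EFinM.
rewrite ge0_integralZl_EFin //; last 2 first.
- by move=> v _; rewrite lee_fin.
- by apply/measurable_EFinP/measurable_funTS; exact: measurable_kernel.
have := integral_gamma_density_scale s T `]0, T * L] T0 (measurable_itv _).
rewrite (_ : [set v | `]0, T * L]%classic (T * v)] = `]0, L]%classic); last first.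
  by apply/seteqP; split => v /=; rewrite !in_itv /= pmulr_rgt0 // ler_pM2l.
move=> ->; last by move=> v /=; rewrite !in_itv /= andbT => /andP[].
rewrite integral_gamma_density_lower ?mulr_ge0 ?(ltW T0) // -!EFinM /cfun.
congr EFin.
have -> : 1 + T - 1 = T by ring.
rewrite /K powRN.
set c := fine _.
by field; rewrite !gt_eqF ?powR_gt0 ?Gammaf_gt0.
Qed.

(** The integral of [W] against [size_gf] is computed termwise and by [tonelli_size_gf]; equate and
    divide by [T ^ s]. *)
Lemma cvg_size_moment :
  series u @ \oo --> T `^ (- s) * fine (\int[mu]_(eta in `]0%R, 1%R])
    (1 - cfun p eta s (1 + T) / Gammaf s)%:E)%E.
Proof.
rewrite (_ : (\int[mu]_(eta in _) _ = (T `^ s * limn (series u))%:E)%E).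
  by rewrite /= mulrA powRN mulVf ?mul1r // gt_eqF // powR_gt0.
rewrite -integral_W_size_gf (tonelli_size_gf p op) //.
apply: eq_integral => eta; rewrite inE /= in_itv /= => eta01.
by rewrite integral_W_lower.
Qed.

End moment.

Theorem theoremB1 (R : realType) (p : nat -> R) (alpha t : R) :
  offspring_dist p -> alpha < 0 -> 1 < t ->
  (fun N : nat => \sum_(1 <= n < N) (gw_size_prob p n * (n%:R - 1 + t) `^ alpha))
    @ \oo -->
  (t - 1) `^ alpha *
    fine (\int[lebesgue_measure]_(eta in `]0%R, 1%R])
            (1 - cfun p eta (- alpha) t / Gammaf (- alpha))%:E)%E.
Proof.
move=> op alpha0 t1.
have s0 : 0 < - alpha by rewrite oppr_gt0.
have T0 : 0 < t - 1 by rewrite subr_gt0.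
have := cvg_size_moment p (- alpha) (t - 1) op s0 T0.
rewrite opprK [1 + _]addrC subrK.
rewrite [X in (X @ _ --> _) -> _](_ : _ =
  fun N => \sum_(1 <= n < N) (gw_size_prob p n * (n%:R - 1 + t) `^ alpha)) //.
(* [series] starts at index 0, whose term is 0 by [fpass p 0 1 = 0]; it is split off to match the
   sum from 1. *)
apply/funext => -[|N]; rewrite /series /=; first by rewrite !big_geq.
rewrite big_ltn // mul0r add0r big_nat [RHS]big_nat; apply: eq_bigr => n /andP[n1 _].
rewrite gw_size_prob_fpass //; congr (_ * _ `^ _); ring.
Qed.
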